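(* Let $\varepsilon>0$, $L>0$, $\widehat{\mathcal U}_0\in\mathbb R$, and let $\theta:[0,L]\to\mathbb R$ be a solution of $$\theta''+2\varepsilon\sin2\theta=0,\qquad \theta'(0)=\theta'(L)=\widehat{\mathcal U}_0,$$ which is a perversion, i.e. $\theta(L-R)=-\theta(R)$ for all $R\in[0,L]$ and $\theta'(R)\neq0$ for all $R\in(0,L)$. Let $\theta_0=\theta(L)$, and assume $|\theta_0|<\pi$. Consider the functional $$\mathscr E[\theta]=\int_0^L\tfrac12\big(\theta'(R)-\widehat{\mathcal U}_0\big)^2+\varepsilon\cos2\theta(R)\,\mathrm dR$$ with free endpoint values. (i) If $|\theta_0|<\pi/2$, then $\theta$ is unstable, i.e. it is not a local minimum of $\mathscr E$. (ii) If $|\theta_0|>\pi/2$, then $\theta$ is stable, i.e. it is a local minimum of $\mathscr E$.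
   Context: ''Local minimum'' is understood among all nearby $C^1$ functions on $[0,L]$ (nearness in the $C^1$ norm), with no constraint on the values $\theta(0),\theta(L)$. The given boundary value problem is the Euler–Lagrange equation of $\mathscr E$ with natural boundary conditions; $\theta(R)$ is the angle between the tangents of the two flanges of the ladder. *)

(* Defs.v *)
From Stdlib Require Import Reals ClassicalEpsilon.
From Coquelicot Require Import Coquelicot.
Open Scope R_scope.

Definition segment (a b x : R) : Prop := a <= x <= b.

(** Functions on [[a, b]] are total functions of which only the values on
    [[a, b]] matter.  Their derivative is therefore the limit of the difference
    quotient relative to [[a, b]], hence one-sided at [a] and [b]; Coquelicot's
    [Derive] would see the values outside [[a, b]]. *)
Definition is_derive_on (a b : R) (f : R -> R) (x l : R) : Prop :=
  D_in f (fun _ => l) (segment a b) x.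

Definition ex_derive_on (a b : R) (f : R -> R) (x : R) : Prop :=
  exists l : R, is_derive_on a b f x l.

(** For [a < b] and [x] in [[a, b]] such an [l] is unique. *)
Definition derive_on (a b : R) (f : R -> R) (x : R) : R :=
  epsilon (inhabits 0) (is_derive_on a b f x).

Definition C1_on (a b : R) (f : R -> R) : Prop :=
  forall x : R, segment a b x ->
    ex_derive_on a b f x /\ continue_in (derive_on a b f) (segment a b) x.

Definition sup_norm (a b : R) (f : R -> R) : Rbar :=
  Lub_Rbar (fun r => exists x : R, segment a b x /\ r = Rabs (f x)).

Definition C1_norm (a b : R) (f : R -> R) : Rbar :=
  Rbar_plus (sup_norm a b f) (sup_norm a b (derive_on a b f)).

(** No condition is imposed on the values of the competitors at [a] and [b]. *)
Definition C1_local_min (a b : R) (J : (R -> R) -> R) (f : R -> R) : Prop :=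
  exists delta : R, 0 < delta /\
    forall g : R -> R, C1_on a b g ->
      Rbar_lt (C1_norm a b (fun x => g x - f x)) (Finite delta) ->
      J f <= J g.

Definition energy (eps L U0 : R) (theta : R -> R) : R :=
  RInt (fun s => / 2 * (derive_on 0 L theta s - U0) ^ 2
                 + eps * cos (2 * theta s)) 0 L.

Definition stable (eps L U0 : R) (theta : R -> R) : Prop :=
  C1_local_min 0 L (energy eps L U0) theta.

Definition unstable (eps L U0 : R) (theta : R -> R) : Prop :=
  ~ stable eps L U0 theta.

Definition bvp_solution (eps L U0 : R) (theta : R -> R) : Prop :=
  (forall s : R, segment 0 L s ->
     ex_derive_on 0 L theta s /\
     ex_derive_on 0 L (derive_on 0 L theta) s /\
     derive_on 0 L (derive_on 0 L theta) s + 2 * eps * sin (2 * theta s) = 0) /\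
  derive_on 0 L theta 0 = U0 /\
  derive_on 0 L theta L = U0.

Definition perversion (L : R) (theta : R -> R) : Prop :=
  (forall s : R, segment 0 L s -> theta (L - s) = - theta s) /\
  (forall s : R, 0 < s < L -> derive_on 0 L theta s <> 0).

(* Main.v *)
Require Import Defs.
From Stdlib Require Import Reals.
From Coquelicot Require Import Coquelicot.
From Stdlib Require Import Lra ClassicalEpsilon Ranalysis5.
Open Scope R_scope.

(** Write [psi] for [theta'], [c0] for [cos (2 * theta0)] and [s0] for
    [sin (2 * theta0)].  The equation [theta'' = - 2 eps sin (2 theta)] has the
    first integral [psi ^ 2 = U0 ^ 2 + 2 eps (cos (2 theta) - c0)], and since
    [theta] increases or decreases strictly from [- theta0] to [theta0],
    [U0 * theta0 >= 0] and [theta0 <> 0].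

    Instability, [|theta0| < PI / 2].  Since [psi] solves the linearised
    equation, the second variation of the energy in the direction [psi + c],
    [c] constant, is the integral of an exact derivative plus
    [- 4 eps c ^ 2 cos (2 theta)].  The boundary terms give
    [- 4 eps (U0 + 2 c) s0], which for [c = s0 / L] outweighs the remaining
    integral because [U0 * s0 >= 0].  Hence the energy of
    [theta + t (theta' + c)] drops by at least a multiple of [t ^ 2] for small
    [t > 0] ([perversion_energy_drop]).  The constant [c] is what makes this
    work when [U0 = 0], where the second variation vanishes at [psi].

    Stability, [|theta0| > PI / 2].  Now [theta] passes through [PI / 2] or
    [- PI / 2] in the interior, where [psi <> 0]; there the first integral
    gives [U0 ^ 2 > 2 eps (1 + c0)] ([perversion_speed_gap]).  So the function
    [P x] with [P x ^ 2 = U0 ^ 2 + 2 eps (cos (2 x) - c0)] and the sign of [U0]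
    is defined and smooth for every real [x], and [theta' = P theta].
    Completing the square, the energy density of any [g] is
    [(g' - P g) ^ 2 / 2 + (F g)' + eps c0], where [F' = P - U0]
    ([energy_density_calibration]), and the square vanishes for [g = theta].
    So the energy of [g] exceeds that of [theta] by at least the increment of
    [F g - F theta] over the interval, and only the endpoints matter: [F] has a
    local extremum at [theta0] and one of the opposite kind at [- theta0]
    ([slope_primitive_extremum]), in the right order because
    [U0 * theta0 > 0]. *)

(** * Functions differentiable relative to a segment *)

Lemma is_derive_on_unique (a b : R) (f : R -> R) (x l1 l2 : R) :
  a < b -> segment a b x ->
  is_derive_on a b f x l1 -> is_derive_on a b f x l2 -> l1 = l2.
Proof.
  intros hab [hax hxb] h1 h2.
  refine (single_limit _ _ _ _ x _ h1 h2).
  intros alp halp.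
  assert (hm := Rmin_l (alp / 2) ((b - a) / 2)).
  assert (hm' := Rmin_r (alp / 2) ((b - a) / 2)).
  assert (hm0 : 0 < Rmin (alp / 2) ((b - a) / 2)) by (apply Rmin_glb_lt; lra).
  set (m := Rmin (alp / 2) ((b - a) / 2)) in *.
  unfold D_x, segment, Rdist.
  destruct (Rle_dec x ((a + b) / 2)).
  - exists (x + m). repeat split; try lra.
    replace (x + m - x) with m by ring. rewrite Rabs_pos_eq; lra.
  - exists (x - m). repeat split; try lra.
    replace (x - m - x) with (- m) by ring.
    rewrite Rabs_Ropp, Rabs_pos_eq; lra.
Qed.

Lemma derive_on_unique (a b : R) (f : R -> R) (x l : R) :
  a < b -> segment a b x -> is_derive_on a b f x l -> derive_on a b f x = l.
Proof.
  intros hab hx h.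
  apply (is_derive_on_unique a b f x); auto.
  unfold derive_on. apply epsilon_spec. now exists l.
Qed.

Lemma is_derive_on_of_is_derive (a b : R) (f g : R -> R) (x l : R) :
  (forall y, segment a b y -> f y = g y) -> segment a b x ->
  is_derive g x l -> is_derive_on a b f x l.
Proof.
  intros hfg hx hg eta heta.
  apply is_derive_Reals in hg.
  destruct (hg eta heta) as [[d hd] hq]; simpl in hq.
  exists d. split; [exact hd |].
  intros y [[hy hyx] hdist]. simpl in *. unfold Rdist in *.
  rewrite (hfg y hy), (hfg x hx).
  specialize (hq (y - x)).
  replace (x + (y - x)) with y in hq by ring.
  apply hq; auto. intro h0. apply hyx. lra.
Qed.

Definition clamp (a b y : R) : R := Rmax a (Rmin b y).

Lemma clamp_segment (a b y : R) : a < b -> segment a b (clamp a b y).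
Proof.
  intros hab. unfold clamp, segment, Rmax, Rmin.
  destruct (Rle_dec b y); destruct (Rle_dec _ _); lra.
Qed.

Lemma clamp_id (a b y : R) : segment a b y -> clamp a b y = y.
Proof.
  unfold clamp, segment, Rmax, Rmin. intros hy.
  destruct (Rle_dec b y); destruct (Rle_dec _ _); lra.
Qed.

Lemma clamp_dist (a b x y : R) :
  segment a b x -> Rabs (clamp a b y - x) <= Rabs (y - x).
Proof.
  unfold clamp, segment, Rmax, Rmin. intros hx.
  destruct (Rle_dec b y); destruct (Rle_dec _ _);
    unfold Rabs; repeat destruct (Rcase_abs _); lra.
Qed.

(** Continuing [f] outside the segment along its tangents at the endpoints
    turns one-sided derivatives into ordinary ones, so that the calculus of
    functions on the line applies on the closed segment. *)
Lemma derivable_extension (a b : R) (f : R -> R) :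
  a < b -> (forall x, segment a b x -> ex_derive_on a b f x) ->
  exists F : R -> R, forall x, segment a b x ->
    F x = f x /\ is_derive F x (derive_on a b f x).
Proof.
  intros hab hf.
  exists (fun y => f (clamp a b y)
                   + derive_on a b f (clamp a b y) * (y - clamp a b y)).
  intros x hx. split; [rewrite clamp_id by auto; ring |].
  assert (hd : is_derive_on a b f x (derive_on a b f x))
    by (unfold derive_on; apply epsilon_spec, hf, hx).
  set (l := derive_on a b f x) in *.
  apply is_derive_Reals. intros eta heta.
  destruct (hd eta heta) as [alp [halp hq]]. simpl in hq. unfold Rdist in hq.
  (* Steps shorter than [d] leave the segment only at an endpoint [x], where
     the extension has the exact slope [l]. *)
  assert (exists d, 0 < d /\ d <= alp /\ (a < x -> d <= x - a)
                    /\ (x < b -> d <= b - x)) as (d & hd0 & hda & hdl & hdr).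
  { set (da := if Rlt_dec a x then x - a else 1).
    set (db := if Rlt_dec x b then b - x else 1).
    assert (0 < da) by (unfold da; destruct (Rlt_dec a x); lra).
    assert (0 < db) by (unfold db; destruct (Rlt_dec x b); lra).
    assert (h1 := Rmin_l alp (Rmin da db)).
    assert (h2 := Rmin_r alp (Rmin da db)).
    assert (h3 := Rmin_l da db). assert (h4 := Rmin_r da db).
    exists (Rmin alp (Rmin da db)).
    split; [repeat apply Rmin_glb_lt; lra | split; [lra |]].
    unfold da, db in *.
    destruct (Rlt_dec a x); destruct (Rlt_dec x b); lra. }
  exists (mkposreal d hd0). simpl. intros h hh0 hhd.
  rewrite (clamp_id a b x hx).
  destruct hx as [hax hxb].
  apply Rabs_def2 in hhd.
  destruct (Rle_dec a (x + h)) as [hay | hay];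
    [destruct (Rle_dec (x + h) b) as [hyb | hyb] |].
  - rewrite clamp_id by (split; lra).
    specialize (hq (x + h)).
    replace (x + h - x) with h in hq by ring.
    replace (f (x + h) + derive_on a b f (x + h) * (x + h - (x + h))
             - (f x + derive_on a b f x * (x - x)))
      with (f (x + h) - f x) by ring.
    apply hq. repeat split; try lra. apply Rabs_def1; lra.
  - assert (x = b) by (destruct (Rlt_dec x b) as [hlt|]; [specialize (hdr hlt) |]; lra).
    assert (hc : clamp a b (x + h) = x).
    { unfold clamp. rewrite Rmin_left by lra. rewrite Rmax_right; lra. }
    rewrite hc. fold l.
    replace ((f x + l * (x + h - x) - (f x + l * (x - x))) / h - l) with 0
      by (field; auto).
    rewrite Rabs_R0. exact heta.
  - assert (x = a) by (destruct (Rlt_dec a x) as [hlt|]; [specialize (hdl hlt) |]; lra).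
    assert (hc : clamp a b (x + h) = x).
    { unfold clamp. rewrite Rmin_right by lra. rewrite Rmax_left; lra. }
    rewrite hc. fold l.
    replace ((f x + l * (x + h - x) - (f x + l * (x - x))) / h - l) with 0
      by (field; auto).
    rewrite Rabs_R0. exact heta.
Qed.

Lemma continue_in_clamp (a b : R) (h : R -> R) (x : R) :
  a < b -> segment a b x -> continue_in h (segment a b) x ->
  continuous (fun y => h (clamp a b y)) x.
Proof.
  intros hab hx hc.
  apply continuity_pt_filterlim. intros eta heta.
  destruct (hc eta heta) as [alp [halp hq]].
  exists alp. split; [exact halp |].
  intros y [_ hy]. simpl in *. unfold Rdist in *.
  rewrite (clamp_id a b x hx).
  destruct (Req_dec x (clamp a b y)) as [he | hne].
  - rewrite <- he, Rminus_diag, Rabs_R0. exact heta.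
  - apply hq. repeat split; try apply clamp_segment; auto.
    eapply Rle_lt_trans; [apply clamp_dist |]; eauto.
Qed.

Lemma continue_in_of_continuous (a b : R) (h k : R -> R) (x : R) :
  (forall y, segment a b y -> h y = k y) -> segment a b x ->
  continuous k x -> continue_in h (segment a b) x.
Proof.
  intros hhk hx hk eta heta.
  apply continuity_pt_filterlim in hk.
  destruct (hk eta heta) as [alp [halp hq]].
  exists alp. split; [exact halp |].
  intros y [[hy hne] hyd]. simpl in *.
  rewrite (hhk y hy), (hhk x hx). apply hq. repeat split; auto.
Qed.

Lemma C1_extension (a b : R) (g : R -> R) :
  a < b -> C1_on a b g ->
  exists G dG : R -> R, forall x, segment a b x ->
    G x = g x /\ derive_on a b g x = dG x /\ is_derive G x (dG x)
    /\ continuous dG x.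
Proof.
  intros hab hg.
  destruct (derivable_extension a b g hab (fun x hx => proj1 (hg x hx)))
    as [G hG].
  exists G, (fun y => derive_on a b g (clamp a b y)).
  intros x hx. rewrite (clamp_id a b x hx).
  repeat split; try (apply hG, hx).
  apply continue_in_clamp; auto. apply hg, hx.
Qed.

Lemma C1_restriction (a b : R) (G dG : R -> R) :
  a < b ->
  (forall x, segment a b x -> is_derive G x (dG x) /\ continuous dG x) ->
  C1_on a b G.
Proof.
  intros hab hG.
  assert (hd : forall x, segment a b x -> is_derive_on a b G x (dG x)).
  { intros x hx. apply (is_derive_on_of_is_derive a b G G); auto. apply hG, hx. }
  intros x hx. split; [now exists (dG x); apply hd |].
  apply continue_in_of_continuous with dG; auto; [| apply hG, hx].
  intros y hy. apply derive_on_unique; auto.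
Qed.

(** * The C1 norm *)

Lemma sup_norm_ge (a b : R) (f : R -> R) (x : R) :
  segment a b x -> Rbar_le (Rabs (f x)) (sup_norm a b f).
Proof.
  intros hx.
  apply (proj1 (Lub_Rbar_correct (fun r => exists y, segment a b y /\ r = Rabs (f y)))).
  now exists x.
Qed.

Lemma sup_norm_le (a b : R) (f : R -> R) (M : R) :
  (forall x, segment a b x -> Rabs (f x) <= M) ->
  Rbar_le (sup_norm a b f) M.
Proof.
  intros hM.
  apply (proj2 (Lub_Rbar_correct (fun r => exists y, segment a b y /\ r = Rabs (f y)))).
  intros r [x [hx ->]]. apply hM, hx.
Qed.

Lemma C1_norm_le (a b : R) (f : R -> R) (M N : R) :
  (forall x, segment a b x -> Rabs (f x) <= M) ->
  (forall x, segment a b x -> Rabs (derive_on a b f x) <= N) ->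
  Rbar_le (C1_norm a b f) (M + N).
Proof.
  intros hM hN.
  exact (Rbar_plus_le_compat _ M _ N (sup_norm_le _ _ _ _ hM) (sup_norm_le _ _ _ _ hN)).
Qed.

(** Both summands of the norm are nonnegative, possibly infinite, so each is
    bounded by the sum. *)
Lemma C1_norm_gt (a b : R) (f : R -> R) (delta x : R) :
  segment a b x -> Rbar_lt (C1_norm a b f) delta -> Rabs (f x) < delta.
Proof.
  intros hx hn.
  apply (Rbar_le_lt_trans (Rabs (f x)) (C1_norm a b f) delta); auto.
  replace (Finite (Rabs (f x))) with (Rbar_plus (Rabs (f x)) 0)
    by (simpl; now rewrite Rplus_0_r).
  apply Rbar_plus_le_compat; [now apply sup_norm_ge |].
  apply Rbar_le_trans with (Rabs (derive_on a b f x)); [apply Rabs_pos |].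
  now apply (sup_norm_ge a b (derive_on a b f)).
Qed.

(** Both halves of the theorem compare two energies in this way: the
    difference of the densities is at most an exact derivative. *)
(** * Comparison of energies *)

Lemma RInt_diff_le (f g H h : R -> R) (a b : R) :
  a <= b ->
  (forall x, segment a b x -> continuous f x /\ continuous g x) ->
  (forall x, segment a b x -> is_derive H x (h x) /\ continuous h x) ->
  (forall x, segment a b x -> f x - g x <= h x) ->
  RInt f a b - RInt g a b <= H b - H a.
Proof.
  intros hab hfg hH hle.
  assert (hseg : forall x, Rmin a b <= x <= Rmax a b -> segment a b x)
    by (rewrite Rmin_left, Rmax_right by auto; auto).
  assert (hf : ex_RInt f a b).
  { apply (@ex_RInt_continuous R_CompleteNormedModule).
    intros; now apply hfg, hseg. }
  assert (hg : ex_RInt g a b).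
  { apply (@ex_RInt_continuous R_CompleteNormedModule).
    intros; now apply hfg, hseg. }
  assert (hh : is_RInt h a b (minus (H b) (H a))).
  { apply (@is_RInt_derive R_CompleteNormedModule H h);
      intros; now apply hH, hseg. }
  assert (hm := is_RInt_minus _ _ _ _ _ _ (RInt_correct f a b hf) (RInt_correct g a b hg)).
  apply (is_RInt_le _ _ _ _ _ _ hab hm hh).
  intros x hx. apply hle. split; lra.
Qed.

Lemma energy_eq (eps L U0 : R) (g G dG : R -> R) :
  0 < L ->
  (forall x, segment 0 L x -> G x = g x /\ derive_on 0 L g x = dG x) ->
  energy eps L U0 g
  = RInt (fun s => / 2 * (dG s - U0) ^ 2 + eps * cos (2 * G s)) 0 L.
Proof.
  intros hL hG. apply RInt_ext. intros x hx.
  rewrite Rmin_left, Rmax_right in hx by lra.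
  destruct (hG x) as [h1 h2]; [split; lra |]. now rewrite h1, h2.
Qed.

Lemma continuous_energy_density (eps U0 : R) (G dG : R -> R) (x : R) :
  continuous G x -> continuous dG x ->
  continuous (fun s => / 2 * (dG s - U0) ^ 2 + eps * cos (2 * G s)) x.
Proof.
  intros hG hdG.
  apply (continuous_plus (fun s => / 2 * (dG s - U0) ^ 2)
           (fun s => eps * cos (2 * G s))).
  - apply (continuous_comp dG (fun p => / 2 * (p - U0) ^ 2)); auto.
    apply (@ex_derive_continuous R_AbsRing R_NormedModule). auto_derive. auto.
  - apply (continuous_comp G (fun y => eps * cos (2 * y))); auto.
    apply (@ex_derive_continuous R_AbsRing R_NormedModule). auto_derive. auto.
Qed.

(** * Perversions as orbits of the pendulum equation *)

(** A perversion through everywhere defined extensions [T] of [theta] and [Psi]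
    of [theta'].  They are two separate tangential extensions, so that both are
    differentiable up to the endpoints; outside the segment [Psi] need not be
    the derivative of [T]. *)
Record perversion_orbit (eps L U0 theta0 : R) (T Psi : R -> R) : Prop := {
  orbit_dT : forall x, segment 0 L x -> is_derive T x (Psi x);
  orbit_dPsi : forall x, segment 0 L x ->
    is_derive Psi x (- 2 * eps * sin (2 * T x));
  orbit_Psi0 : Psi 0 = U0;
  orbit_PsiL : Psi L = U0;
  orbit_T0 : T 0 = - theta0;
  orbit_TL : T L = theta0;
  orbit_monotone : forall x, 0 < x < L -> Psi x <> 0
}.

Lemma perversion_orbit_of_solution (eps L U0 : R) (theta : R -> R) :
  0 < L -> bvp_solution eps L U0 theta -> perversion L theta ->
  exists T Psi : R -> R,
    (forall x, segment 0 L x -> T x = theta x /\ derive_on 0 L theta x = Psi x)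
    /\ perversion_orbit eps L U0 (theta L) T Psi.
Proof.
  intros hL [hode [h0 hLU]] [hodd hmon].
  destruct (derivable_extension 0 L theta hL (fun x hx => proj1 (hode x hx)))
    as [T hT].
  destruct (derivable_extension 0 L (derive_on 0 L theta) hL
              (fun x hx => proj1 (proj2 (hode x hx)))) as [Psi hPsi].
  assert (s0 : segment 0 L 0) by (split; lra).
  assert (sL : segment 0 L L) by (split; lra).
  exists T, Psi. split.
  { intros x hx. split; [apply hT, hx | symmetry; apply hPsi, hx]. }
  split.
  - intros x hx. rewrite (proj1 (hPsi x hx)). apply hT, hx.
  - intros x hx. rewrite (proj1 (hT x hx)).
    destruct (hode x hx) as [_ [_ h]].
    replace (- 2 * eps * sin (2 * theta x))
      with (derive_on 0 L (derive_on 0 L theta) x) by lra.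
    apply hPsi, hx.
  - now rewrite (proj1 (hPsi 0 s0)).
  - now rewrite (proj1 (hPsi L sL)).
  - rewrite (proj1 (hT 0 s0)), <- (hodd L sL). f_equal. ring.
  - apply hT, sL.
  - intros x hx. assert (sx : segment 0 L x) by (split; lra).
    rewrite (proj1 (hPsi x sx)). now apply hmon.
Qed.

Lemma continuous_of_is_derive (f : R -> R) (x l : R) :
  is_derive f x l -> continuous f x.
Proof.
  intros h. apply (@ex_derive_continuous R_AbsRing R_NormedModule).
  now exists l.
Qed.

Lemma Derive_of_is_derive (f : R -> R) (x l : R) :
  is_derive f x l -> Derive (fun y : R => f y) x = l.
Proof. exact (is_derive_unique f x l). Qed.

(** The sign is that of an interior value, and passes to the endpoints, where
    [f] may vanish: hence the weak inequality. *)
Lemma nonvanishing_sign (f : R -> R) (L x y : R) :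
  (forall z, segment 0 L z -> continuous f z) ->
  (forall z, 0 < z < L -> f z <> 0) ->
  0 < x < L -> segment 0 L y -> 0 <= f x * f y.
Proof.
  intros hc hnz hx hy.
  destruct (Rle_dec 0 (f x * f y)) as [|hneg]; [auto | exfalso].
  apply Rnot_le_lt in hneg.
  assert (hxx : 0 < f x * f x) by (apply Rsqr_pos_lt, hnz, hx).
  assert (hcont : forall k z, segment 0 L z -> continuity_pt (fun u => k * f u) z).
  { intros k z hz. apply continuity_pt_scal, continuity_pt_filterlim, hc, hz. }
  unfold segment in *.
  destruct (Rtotal_order x y) as [h | [h | h]].
  - destruct (IVT_interv (fun u => - f x * f u) x y) as [z [hz hz0]]; try lra.
    + intros u hu. apply hcont. lra.
    + assert (z <> y) by (intros ->; lra).
      apply (hnz z); [lra |]. apply Rmult_integral in hz0. destruct hz0; [|auto].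
      exfalso. apply (hnz x hx). lra.
  - subst y. lra.
  - destruct (IVT_interv (fun u => f x * f u) y x) as [z [hz hz0]]; try lra.
    + intros u hu. apply hcont. lra.
    + assert (z <> y) by (intros ->; lra).
      apply (hnz z); [lra |]. apply Rmult_integral in hz0. destruct hz0; [|auto].
      exfalso. now apply (hnz x hx).
Qed.

(** The mean value theorem gives [2 theta0 = L theta' xi] for some interior
    [xi]; there [theta'] is nonzero, and its sign is not opposite to that of the
    end value [U0]. *)
Lemma perversion_sign (eps L U0 theta0 : R) (T Psi : R -> R) :
  0 < L -> perversion_orbit eps L U0 theta0 T Psi ->
  theta0 <> 0 /\ 0 <= U0 * theta0.
Proof.
  intros hL [hT hPsi h0 hUL hT0 hTL hmon].
  destruct (MVT_cor2 T Psi 0 L hL) as [xi [hxi hxi']].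
  { intros c hc. apply is_derive_Reals, hT, hc. }
  assert (hs : 0 <= Psi xi * Psi L).
  { apply nonvanishing_sign with L; auto; [| split; lra].
    intros z hz. now apply continuous_of_is_derive with (1 := hPsi z hz). }
  assert (hn := hmon xi hxi').
  rewrite hT0, hTL in hxi. rewrite hUL in hs.
  assert (he : theta0 = Psi xi * (L / 2)) by lra.
  split.
  - rewrite he. apply Rmult_integral_contrapositive. split; lra.
  - rewrite he. replace (U0 * (Psi xi * (L / 2))) with ((Psi xi * U0) * (L / 2)) by ring.
    apply Rmult_le_pos; lra.
Qed.

Lemma first_integral (eps L U0 theta0 : R) (T Psi : R -> R) (x : R) :
  perversion_orbit eps L U0 theta0 T Psi -> segment 0 L x ->
  Psi x ^ 2 = U0 ^ 2 + 2 * eps * (cos (2 * T x) - cos (2 * theta0)).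
Proof.
  intros [hT hPsi h0 hUL hT0 hTL hmon] hx.
  destruct (Req_dec x L) as [-> | hne]; [rewrite hUL, hTL; ring |].
  assert (hc : Psi x ^ 2 - 2 * eps * cos (2 * T x)
               = Psi L ^ 2 - 2 * eps * cos (2 * T L)).
  { unfold segment in *.
    apply (eq_is_derive (fun z => Psi z ^ 2 - 2 * eps * cos (2 * T z)) x L); [|lra].
    intros z hz.
    assert (d1 := hT z ltac:(lra)). assert (d2 := hPsi z ltac:(lra)).
    assert (eT : ex_derive T z) by (now exists (Psi z)).
    assert (eP : ex_derive Psi z) by (now exists (- 2 * eps * sin (2 * T z))).
    evar_last; [auto_derive; [repeat split; auto | reflexivity] |].
    rewrite (Derive_of_is_derive T _ _ d1), (Derive_of_is_derive Psi _ _ d2).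
    unfold zero; simpl. ring. }
  rewrite hUL, hTL in hc. lra.
Qed.

(** * Instability for small end angles *)

(** The difference of the two sides and its first two derivatives in [b] vanish
    at [b = 0], and its third derivative [1 - sin (a + b)] is nonnegative. *)
Lemma cos_taylor_nonneg (a b : R) :
  0 <= b -> cos (a + b) <= cos a - b * sin a - b ^ 2 / 2 * cos a + b ^ 3 / 6.
Proof.
  (* Applied three times, for the expression and its first two derivatives. *)
  assert (mono : forall k k' : R -> R, k 0 = 0 ->
            (forall x, is_derive k x (k' x)) ->
            (forall x, 0 <= x -> 0 <= k' x) -> forall x, 0 <= x -> 0 <= k x).
  { intros k k' h0 hd hp x hx.
    destruct (MVT_gen k 0 x k') as [c [hc he]].
    - intros; apply hd.
    - intros z _. apply continuity_pt_filterlim.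
      now apply continuous_of_is_derive with (1 := hd z).
    - rewrite Rmin_left, Rmax_right in hc by auto.
      rewrite h0 in he. rewrite Rminus_0_r, Rminus_0_r in he. rewrite he.
      apply Rmult_le_pos; [apply hp |]; lra. }
  intros hb.
  cut (0 <= cos a - b * sin a - b ^ 2 / 2 * cos a + b ^ 3 / 6 - cos (a + b)); [lra |].
  revert b hb.
  apply mono with (fun b => - sin a - b * cos a + b ^ 2 / 2 + sin (a + b)).
  { rewrite !Rplus_0_r. field. }
  { intros x. auto_derive; auto. field. }
  apply mono with (fun b => - cos a + b + cos (a + b)).
  { rewrite !Rplus_0_r. field. }
  { intros x. auto_derive; auto. field. }
  apply mono with (fun b => 1 - sin (a + b)).
  { rewrite !Rplus_0_r. field. }
  { intros x. auto_derive; auto. field. }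
  intros x _. assert (h := SIN_bound (a + x)). lra.
Qed.

Lemma cos_taylor (a b : R) :
  cos (a + b) <= cos a - b * sin a - b ^ 2 / 2 * cos a + Rabs b ^ 3 / 6.
Proof.
  destruct (Rle_dec 0 b) as [hb | hb].
  - rewrite Rabs_pos_eq by auto. now apply cos_taylor_nonneg.
  - rewrite Rabs_left by lra.
    assert (h := cos_taylor_nonneg (- a) (- b) ltac:(lra)).
    replace (- a + - b) with (- (a + b)) in h by ring.
    rewrite !cos_neg, sin_neg in h.
    replace (- b * - sin a) with (b * sin a) in h by ring.
    replace ((- b) ^ 2) with (b ^ 2) in h by ring. exact h.
Qed.

(** The coefficients of [t] and [t ^ 2] are the first and half the second
    variation of the density; [M] controls the cubic remainder of the cosine. *)
Lemma energy_density_expansion (eps U0 th p phi dphi t M : R) :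
  0 < eps -> 0 <= t -> Rabs phi <= M ->
  / 2 * (p + t * dphi - U0) ^ 2 + eps * cos (2 * (th + t * phi))
  - (/ 2 * (p - U0) ^ 2 + eps * cos (2 * th))
  <= t * ((p - U0) * dphi - 2 * eps * sin (2 * th) * phi)
     + t ^ 2 / 2 * (dphi ^ 2 - 4 * eps * cos (2 * th) * phi ^ 2)
     + 4 / 3 * eps * M ^ 3 * t ^ 3.
Proof.
  intros heps ht hM.
  assert (hc := cos_taylor (2 * th) (2 * (t * phi))).
  replace (2 * (th + t * phi)) with (2 * th + 2 * (t * phi)) by ring.
  assert (hb : Rabs (2 * (t * phi)) ^ 3 <= (2 * t * M) ^ 3).
  { apply pow_incr. split; [apply Rabs_pos |].
    rewrite !Rabs_mult, (Rabs_pos_eq 2), (Rabs_pos_eq t) by lra.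
    rewrite Rmult_assoc. apply Rmult_le_compat_l; [lra |].
    now apply Rmult_le_compat_l. }
  assert (hc' : cos (2 * th + 2 * (t * phi))
    <= cos (2 * th) - 2 * (t * phi) * sin (2 * th)
       - (2 * (t * phi)) ^ 2 / 2 * cos (2 * th) + (2 * t * M) ^ 3 / 6) by lra.
  apply (Rmult_le_compat_l eps) in hc'; [| lra].
  lra.
Qed.

(** The competitor is [theta + t phi] with [phi = theta' + c].  The first
    variation of the density is the derivative of [(theta' - U0) phi], which
    vanishes at both ends.  Since [theta''' = - 4 eps cos (2 theta) theta'],
    the second variation of the density is the derivative of
    [(theta' + 2 c) theta''] minus [4 eps c ^ 2 cos (2 theta)].  The boundary
    terms contribute [- 2 eps t ^ 2 (U0 + 2 c) s0] to the energy, the rest at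
    most [2 eps c ^ 2 t ^ 2 L], where [s0 = sin (2 theta0)].  The choice
    [c = s0 / L] minimises [- 4 eps c s0 + 2 eps c ^ 2 L]. *)
Lemma perversion_energy_drop (eps L U0 theta0 t M : R) (T Psi : R -> R) :
  let c := sin (2 * theta0) / L in
  0 < eps -> 0 < L -> 0 <= U0 * sin (2 * theta0) ->
  perversion_orbit eps L U0 theta0 T Psi -> 0 <= t ->
  (forall x, segment 0 L x -> Rabs (Psi x + c) <= M) ->
  RInt (fun s => / 2 * (Psi s + t * (- 2 * eps * sin (2 * T s)) - U0) ^ 2
                 + eps * cos (2 * (T s + t * (Psi s + c)))) 0 L
  - RInt (fun s => / 2 * (Psi s - U0) ^ 2 + eps * cos (2 * T s)) 0 L
  <= t ^ 2 * (4 / 3 * eps * M ^ 3 * L * t - 2 * eps * sin (2 * theta0) ^ 2 / L).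
Proof.
  intros c heps hL hsign horb ht hM.
  destruct horb as [hT hPsi h0 hUL hT0 hTL hmon].
  set (H := fun s => t * ((Psi s - U0) * (Psi s + c))
    + t ^ 2 / 2 * ((Psi s + 2 * c) * (- 2 * eps * sin (2 * T s)))
    + (2 * eps * c ^ 2 * t ^ 2 + 4 / 3 * eps * M ^ 3 * t ^ 3) * s).
  set (h := fun s =>
    t * ((Psi s - U0) * (- 2 * eps * sin (2 * T s))
         - 2 * eps * sin (2 * T s) * (Psi s + c))
    + t ^ 2 / 2 * ((- 2 * eps * sin (2 * T s)) ^ 2
                   - 4 * eps * cos (2 * T s) * (Psi s * (Psi s + 2 * c)))
    + (2 * eps * c ^ 2 * t ^ 2 + 4 / 3 * eps * M ^ 3 * t ^ 3)).
  apply Rle_trans with (H L - H 0).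
  - apply (RInt_diff_le _ _ H h); [lra | | |]; intros x hx;
      assert (dT := hT x hx); assert (dP := hPsi x hx);
      assert (eT : ex_derive T x) by (now exists (Psi x));
      assert (eP : ex_derive Psi x) by (now exists (- 2 * eps * sin (2 * T x))).
    + split; apply (@ex_derive_continuous R_AbsRing R_NormedModule); auto_derive;
        repeat split; auto.
    + split.
      * unfold H, h.
        evar_last; [auto_derive; [repeat split; auto | reflexivity] |].
        rewrite (Derive_of_is_derive T _ _ dT), (Derive_of_is_derive Psi _ _ dP).
        field.
      * apply (@ex_derive_continuous R_AbsRing R_NormedModule). unfold h.
        auto_derive. repeat split; auto.
    + eapply Rle_trans.
      { apply energy_density_expansion with (M := M); auto. }
      unfold h.
      assert (0 <= 2 * eps * c ^ 2 * t ^ 2 * (1 + cos (2 * T x))).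
      { assert (hcb := COS_bound (2 * T x)).
        assert (hc2 := pow2_ge_0 c). assert (ht2 := pow2_ge_0 t).
        apply Rmult_le_pos; [| lra].
        apply Rmult_le_pos; auto. apply Rmult_le_pos; lra. }
      lra.
  - unfold H. rewrite h0, hUL, hT0, hTL.
    replace (2 * - theta0) with (- (2 * theta0)) by ring. rewrite sin_neg.
    assert (hU : 0 <= t ^ 2 * (2 * eps * (U0 * sin (2 * theta0)))).
    { apply Rmult_le_pos; [apply pow2_ge_0 |].
      apply Rmult_le_pos; lra. }
    apply Rminus_le.
    match goal with |- ?e <= 0 =>
      replace e with (- (t ^ 2 * (2 * eps * (U0 * sin (2 * theta0)))))
        by (unfold c; field; lra) end.
    lra.
Qed.

Lemma perversion_unstable (eps L U0 : R) (theta : R -> R) (theta0 : R)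
  (T Psi : R -> R) :
  0 < eps -> 0 < L ->
  (forall x, segment 0 L x ->
     T x = theta x /\ derive_on 0 L theta x = Psi x) ->
  perversion_orbit eps L U0 theta0 T Psi ->
  sin (2 * theta0) <> 0 -> 0 <= U0 * sin (2 * theta0) ->
  unstable eps L U0 theta.
Proof.
  intros heps hL heq horb hs hUs [delta [hdelta hmin]].
  set (c := sin (2 * theta0) / L).
  (* The first integral bounds [theta' ^ 2] by [U0 ^ 2 + 4 eps]; adding [1] makes
     the same bound valid for [theta'] without a square root. *)
  set (M := U0 ^ 2 + 4 * eps + 1 + Rabs c).
  assert (hM : forall x, segment 0 L x -> Rabs (Psi x + c) <= M).
  { intros x hx. unfold M.
    eapply Rle_trans; [apply Rabs_triang |]. apply Rplus_le_compat_r.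
    assert (hI := first_integral _ _ _ _ _ _ x horb hx).
    assert (h1 := COS_bound (2 * T x)). assert (h2 := COS_bound (2 * theta0)).
    assert (h3 : eps * (cos (2 * T x) - cos (2 * theta0)) <= eps * 2)
      by (apply Rmult_le_compat_l; lra).
    assert (h4 := pow2_ge_0 U0).
    apply Rabs_le.
    assert (0 <= (U0 ^ 2 + 4 * eps) ^ 2) by apply pow2_ge_0.
    assert (Psi x ^ 2 <= U0 ^ 2 + 4 * eps) by lra.
    split; nra. }
  assert (hM0 : 1 <= M).
  { unfold M. assert (h1 := Rabs_pos c). assert (h2 := pow2_ge_0 U0). lra. }
  assert (hM3 : 0 < M ^ 3) by (apply pow_lt; lra).
  assert (hs2 : 0 < sin (2 * theta0) ^ 2) by (apply pow2_gt_0; auto).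
  set (A := 4 / 3 * eps * M ^ 3 * L).
  set (B := 2 * eps * sin (2 * theta0) ^ 2 / L).
  assert (hA : 0 < A) by (unfold A; repeat apply Rmult_lt_0_compat; lra).
  assert (hB : 0 < B).
  { unfold B. apply Rdiv_lt_0_compat; auto. apply Rmult_lt_0_compat; lra. }
  assert (exists t, 0 < t /\ t * (M + 2 * eps) < delta /\ A * t < B)
    as (t & ht & htd & htB).
  { assert (p1 : 0 < delta / (M + 2 * eps)) by (apply Rdiv_lt_0_compat; lra).
    assert (p2 : 0 < B / A) by (apply Rdiv_lt_0_compat; lra).
    set (m := Rmin (delta / (M + 2 * eps)) (B / A)).
    assert (hm : 0 < m) by (now apply Rmin_glb_lt).
    assert (l1 : m <= delta / (M + 2 * eps)) by apply Rmin_l.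
    assert (l2 : m <= B / A) by apply Rmin_r.
    exists (m / 2). split; [lra |]. split.
    - apply Rlt_le_trans with (delta / (M + 2 * eps) * (M + 2 * eps)).
      + apply Rmult_lt_compat_r; lra.
      + right. field. lra.
    - apply Rlt_le_trans with (A * (B / A)).
      + apply Rmult_lt_compat_l; lra.
      + right. field. lra. }
  set (g := fun x => T x + t * (Psi x + c)).
  set (dphi := fun x => - 2 * eps * sin (2 * T x)).
  set (dg := fun x => Psi x + t * dphi x).
  assert (hdphi : forall x, segment 0 L x ->
            is_derive (fun y => t * (Psi y + c)) x (t * dphi x)).
  { intros x hx. assert (dP := orbit_dPsi _ _ _ _ _ _ horb x hx).
    evar_last; [auto_derive; [eexists; exact dP | reflexivity] |].
    rewrite (Derive_of_is_derive Psi _ _ dP). unfold dphi. ring. }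
  assert (hg : forall x, segment 0 L x -> is_derive g x (dg x) /\ continuous dg x).
  { intros x hx. split.
    - apply (is_derive_plus T); [now apply (orbit_dT _ _ _ _ _ _ horb) | auto].
    - assert (dT := orbit_dT _ _ _ _ _ _ horb x hx).
      assert (dP := orbit_dPsi _ _ _ _ _ _ horb x hx).
      apply (@ex_derive_continuous R_AbsRing R_NormedModule).
      unfold dg, dphi. auto_derive.
      repeat split; auto; eexists; eauto. }
  assert (hnorm : Rbar_lt (C1_norm 0 L (fun x => g x - theta x)) delta).
  { assert (hdiff : forall x, segment 0 L x ->
              g x - theta x = t * (Psi x + c)).
    { intros x hx. rewrite <- (proj1 (heq x hx)). unfold g. ring. }
    apply Rbar_le_lt_trans with (t * M + t * (2 * eps)).
    - apply C1_norm_le; intros x hx.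
      + rewrite (hdiff x hx), Rabs_mult, (Rabs_pos_eq t) by lra.
        apply Rmult_le_compat_l; [lra | auto].
      + rewrite (derive_on_unique 0 L (fun y => g y - theta y) x (t * dphi x)); auto.
        * rewrite Rabs_mult, (Rabs_pos_eq t) by lra.
          apply Rmult_le_compat_l; [lra |].
          unfold dphi. assert (h := SIN_bound (2 * T x)).
          apply Rabs_le. split; nra.
        * apply is_derive_on_of_is_derive with (fun y => t * (Psi y + c)); auto.
    - simpl. lra. }
  assert (hle := hmin g (C1_restriction 0 L g dg hL hg) hnorm).
  rewrite (energy_eq eps L U0 theta T Psi hL heq) in hle.
  rewrite (energy_eq eps L U0 g g dg hL) in hle.
  2:{ intros x hx. split; [reflexivity |]. apply derive_on_unique; auto.
      apply is_derive_on_of_is_derive with g; auto. now apply hg. }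
  assert (hdrop := perversion_energy_drop eps L U0 theta0 t M T Psi
                     heps hL hUs horb (Rlt_le _ _ ht) hM).
  fold c A B in hdrop. unfold dg, dphi, g in hle.
  assert (t ^ 2 * (A * t - B) < 0).
  { apply Rmult_pos_neg; [apply pow2_gt_0 |]; lra. }
  lra.
Qed.

(** * Stability for large end angles *)

(** The speed [theta'] as a function of the angle [theta], solved from the
    first integral.  Writing it as [U0] times a square root selects the branch
    with the sign of [U0] without a case distinction. *)
Definition slope (eps U0 theta0 x : R) : R :=
  U0 * sqrt (1 + 2 * eps / U0 ^ 2 * (cos (2 * x) - cos (2 * theta0))).

Definition slope_primitive (eps U0 theta0 x : R) : R :=
  RInt (fun y => slope eps U0 theta0 y - U0) 0 x.

Lemma slope_continuous (eps U0 theta0 x : R) :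
  continuous (slope eps U0 theta0) x.
Proof.
  apply (continuous_scal_r U0
    (fun y => sqrt (1 + 2 * eps / U0 ^ 2 * (cos (2 * y) - cos (2 * theta0))))).
  apply continuous_sqrt_comp.
  apply (@ex_derive_continuous R_AbsRing R_NormedModule). auto_derive. auto.
Qed.

Lemma slope_minus_continuous (eps U0 theta0 x : R) :
  continuous (fun y => slope eps U0 theta0 y - U0) x.
Proof.
  apply (continuous_minus (slope eps U0 theta0) (fun _ => U0)).
  - apply slope_continuous.
  - apply continuous_const.
Qed.

Lemma slope_primitive_derive (eps U0 theta0 x : R) :
  is_derive (slope_primitive eps U0 theta0) x (slope eps U0 theta0 x - U0).
Proof.
  apply (is_derive_RInt (fun y => slope eps U0 theta0 y - U0) _ 0).
  - exists (mkposreal 1 Rlt_0_1). intros y _.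
    apply (@RInt_correct R_CompleteNormedModule).
    apply (@ex_RInt_continuous R_CompleteNormedModule).
    intros z _. apply slope_minus_continuous.
  - apply slope_minus_continuous.
Qed.

(** The angle takes the value [PI / 2] or [- PI / 2] at an interior point, where
    the first integral reads
    [theta' ^ 2 = U0 ^ 2 - 2 eps (1 + cos (2 theta0))] and [theta' <> 0].  In
    particular [U0 = 0] is impossible for large end angles. *)
Lemma perversion_speed_gap (eps L U0 theta0 : R) (T Psi : R -> R) :
  0 < eps -> 0 < L -> perversion_orbit eps L U0 theta0 T Psi ->
  PI / 2 < Rabs theta0 ->
  2 * eps * (1 + cos (2 * theta0)) < U0 ^ 2.
Proof.
  intros heps hL horb hth.
  (* Multiplying by the sign of [theta0] treats the crossings of [PI / 2] and of
     [- PI / 2] at once. *)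
  set (sg := if Rle_dec 0 theta0 then 1 else -1).
  assert (hsg : sg * theta0 = Rabs theta0 /\ sg * sg = 1).
  { unfold sg. destruct (Rle_dec 0 theta0).
    - rewrite Rabs_pos_eq; lra.
    - rewrite Rabs_left; lra. }
  destruct hsg as [hsg1 hsg2].
  assert (hpi := PI_RGT_0).
  destruct (IVT_interv (fun x => sg * T x - PI / 2) 0 L) as [z [hz hz0]].
  - intros x hx.
    assert (dT := orbit_dT _ _ _ _ _ _ horb x hx).
    assert (hc : continuous (fun x => sg * T x - PI / 2) x).
    { apply (@ex_derive_continuous R_AbsRing R_NormedModule). auto_derive.
      now exists (Psi x). }
    now apply continuity_pt_filterlim.
  - exact hL.
  - rewrite (orbit_T0 _ _ _ _ _ _ horb). lra.
  - rewrite (orbit_TL _ _ _ _ _ _ horb). lra.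
  - assert (hzT : T z = sg * (PI / 2)).
    { replace (T z) with ((sg * sg) * T z) by (rewrite hsg2; ring).
      rewrite Rmult_assoc. f_equal. lra. }
    assert (hcos : cos (2 * T z) = -1).
    { rewrite hzT. unfold sg. destruct (Rle_dec 0 theta0).
      - replace (2 * (1 * (PI / 2))) with PI by field. apply cos_PI.
      - replace (2 * (-1 * (PI / 2))) with (- PI) by field.
        rewrite cos_neg. apply cos_PI. }
    assert (hz' : 0 < z < L).
    { split; apply Rnot_le_lt; intros hle.
      - replace z with 0 in hz0 by lra.
        rewrite (orbit_T0 _ _ _ _ _ _ horb) in hz0. lra.
      - replace z with L in hz0 by lra.
        rewrite (orbit_TL _ _ _ _ _ _ horb) in hz0. lra. }
    assert (hI := first_integral _ _ _ _ _ _ z horb hz).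
    assert (hp := pow2_gt_0 _ (orbit_monotone _ _ _ _ _ _ horb z hz')).
    rewrite hcos in hI. lra.
Qed.

(** The value at [cos (2 x) = - 1] is the smallest one, and there the speed gap
    gives positivity. *)
Lemma slope_radicand (eps U0 theta0 x : R) :
  0 < eps -> 2 * eps * (1 + cos (2 * theta0)) < U0 ^ 2 ->
  U0 <> 0 /\
  0 < 1 + 2 * eps / U0 ^ 2 * (cos (2 * x) - cos (2 * theta0)).
Proof.
  intros heps hgap.
  assert (h1 := COS_bound (2 * theta0)). assert (h2 := COS_bound (2 * x)).
  assert (h3 : 0 <= eps * (1 + cos (2 * theta0))) by (apply Rmult_le_pos; lra).
  assert (hU : 0 < U0 ^ 2) by lra.
  assert (hU0 : U0 <> 0) by (intros ->; lra).
  split; auto.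
  replace (1 + 2 * eps / U0 ^ 2 * (cos (2 * x) - cos (2 * theta0)))
    with ((U0 ^ 2 + 2 * eps * (cos (2 * x) - cos (2 * theta0))) / U0 ^ 2)
    by (field; auto).
  apply Rdiv_lt_0_compat; auto.
  assert (0 <= eps * (1 + cos (2 * x))) by (apply Rmult_le_pos; lra).
  lra.
Qed.

Lemma slope_sqr (eps U0 theta0 x : R) :
  0 < eps -> 2 * eps * (1 + cos (2 * theta0)) < U0 ^ 2 ->
  slope eps U0 theta0 x ^ 2
  = U0 ^ 2 + 2 * eps * (cos (2 * x) - cos (2 * theta0)).
Proof.
  intros heps hgap.
  destruct (slope_radicand eps U0 theta0 x heps hgap) as [hU hr].
  unfold slope. rewrite Rpow_mult_distr, pow2_sqrt by lra. field. auto.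
Qed.

Lemma orbit_slope (eps L U0 theta0 : R) (T Psi : R -> R) (x : R) :
  0 < eps -> 0 < L -> perversion_orbit eps L U0 theta0 T Psi ->
  2 * eps * (1 + cos (2 * theta0)) < U0 ^ 2 ->
  segment 0 L x -> Psi x = slope eps U0 theta0 (T x).
Proof.
  intros heps hL horb hgap hx.
  destruct (slope_radicand eps U0 theta0 (T x) heps hgap) as [hU hr].
  assert (hPsi := orbit_dPsi _ _ _ _ _ _ horb).
  assert (hcont : forall z, segment 0 L z -> continuous Psi z)
    by (intros z hz; exact (continuous_of_is_derive _ _ _ (hPsi z hz))).
  assert (hsign : 0 <= Psi x * U0).
  { destruct (Req_dec x 0) as [-> | h0].
    { rewrite (orbit_Psi0 _ _ _ _ _ _ horb). apply Rle_0_sqr. }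
    destruct (Req_dec x L) as [-> | hxL].
    { rewrite (orbit_PsiL _ _ _ _ _ _ horb). apply Rle_0_sqr. }
    unfold segment in hx.
    rewrite <- (orbit_PsiL _ _ _ _ _ _ horb).
    apply nonvanishing_sign with L; auto; try (unfold segment; lra).
    apply (orbit_monotone _ _ _ _ _ _ horb). }
  assert (hsq : Psi x ^ 2 = slope eps U0 theta0 (T x) ^ 2).
  { rewrite slope_sqr by auto. now apply first_integral with L. }
  assert (hs2 : 0 < slope eps U0 theta0 (T x) * U0).
  { unfold slope. assert (h := sqrt_lt_R0 _ hr).
    rewrite Rmult_assoc, (Rmult_comm (sqrt _)), <- Rmult_assoc.
    apply Rmult_lt_0_compat; auto. now apply Rsqr_pos_lt. }
  assert (hf : (Psi x - slope eps U0 theta0 (T x))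
               * (Psi x + slope eps U0 theta0 (T x)) = 0) by lra.
  apply Rmult_integral in hf. destruct hf as [hf | hf]; [lra |].
  exfalso. assert ((Psi x + slope eps U0 theta0 (T x)) * U0 = 0)
    by (rewrite hf; ring). lra.
Qed.

(** On the interval of radius [Rmin (|a| - PI / 2) (PI - |a|)] around [a],
    [cos (2 x)] increases if [a > 0] and decreases if [a < 0]. *)
Lemma cos_double_monotone (a xi : R) :
  PI / 2 < Rabs a < PI ->
  Rabs (xi - a) <= Rmin (Rabs a - PI / 2) (PI - Rabs a) ->
  0 <= a * (xi - a) * (cos (2 * xi) - cos (2 * a)).
Proof.
  intros ha hd.
  assert (h1 := Rmin_l (Rabs a - PI / 2) (PI - Rabs a)).
  assert (h2 := Rmin_r (Rabs a - PI / 2) (PI - Rabs a)).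
  assert (hd1 : Rabs (xi - a) <= Rabs a - PI / 2) by lra.
  assert (hd2 : Rabs (xi - a) <= PI - Rabs a) by lra.
  clear hd h1 h2.
  assert (hpi := PI_RGT_0).
  rewrite form2.
  replace ((2 * xi - 2 * a) / 2) with (xi - a) by field.
  replace ((2 * xi + 2 * a) / 2) with (xi + a) by field.
  assert (hA : 0 <= (xi - a) * sin (xi - a)).
  { destruct (Rle_dec 0 (xi - a)) as [h | h].
    - rewrite Rabs_pos_eq in hd2, hd1 by auto.
      apply Rmult_le_pos; auto. apply sin_ge_0; lra.
    - rewrite Rabs_left in hd2, hd1 by lra.
      assert (0 <= sin (- (xi - a))) by (apply sin_ge_0; lra).
      rewrite sin_neg in H.
      replace ((xi - a) * sin (xi - a)) with (- (xi - a) * - sin (xi - a)) by ring.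
      apply Rmult_le_pos; lra. }
  assert (hB : 0 <= a * - sin (xi + a)).
  { apply Rabs_le_between in hd1. apply Rabs_le_between in hd2.
    destruct (Rle_dec 0 a) as [h | h].
    - rewrite Rabs_pos_eq in * by auto.
      apply Rmult_le_pos; auto.
      assert (sin (xi + a) <= 0) by (apply sin_le_0; lra). lra.
    - rewrite Rabs_left in * by lra.
      assert (sin (- (xi + a)) <= 0) by (apply sin_le_0; lra).
      rewrite sin_neg in H.
      replace (a * - sin (xi + a)) with (- a * sin (xi + a)) by ring.
      apply Rmult_le_pos; lra. }
  replace (a * (xi - a) * (-2 * sin (xi - a) * sin (xi + a)))
    with (2 * ((xi - a) * sin (xi - a) * (a * - sin (xi + a)))) by ring.
  apply Rmult_le_pos; [lra |]. now apply Rmult_le_pos.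
Qed.

(** By the mean value theorem the increment of the primitive is
    [(P xi - U0) (y - a)], and [U0 (P xi - U0)] has the sign of
    [cos (2 xi) - cos (2 a)], where [P] is the slope.  The primitive thus has
    a minimum at [a] if [U0 * a > 0] and a maximum if [U0 * a < 0]; both cases
    occur, at [theta0] and at [- theta0]. *)
Lemma slope_primitive_extremum (eps U0 theta0 a y : R) :
  0 < eps -> 2 * eps * (1 + cos (2 * theta0)) < U0 ^ 2 ->
  PI / 2 < Rabs a < PI -> cos (2 * a) = cos (2 * theta0) ->
  Rabs (y - a) <= Rmin (Rabs a - PI / 2) (PI - Rabs a) ->
  0 <= U0 * a * (slope_primitive eps U0 theta0 y - slope_primitive eps U0 theta0 a).
Proof.
  intros heps hgap ha hcos hy.
  destruct (MVT_gen (slope_primitive eps U0 theta0) a y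
              (fun x => slope eps U0 theta0 x - U0)) as [xi [hxi he]].
  { intros; apply slope_primitive_derive. }
  { intros x _. apply continuity_pt_filterlim.
    apply continuous_of_is_derive with (1 := slope_primitive_derive eps U0 theta0 x). }
  rewrite he.
  destruct (slope_radicand eps U0 theta0 xi heps hgap) as [hU hr].
  set (D := cos (2 * xi) - cos (2 * theta0)) in *.
  set (r := 1 + 2 * eps / U0 ^ 2 * D) in *.
  assert (hsq := sqrt_lt_R0 r hr).
  assert (hm : U0 * (slope eps U0 theta0 xi - U0) = 2 * eps / (sqrt r + 1) * D).
  { unfold slope. fold D r.
    assert (hD : 2 * eps * D = U0 ^ 2 * (sqrt r * sqrt r - 1)).
    { rewrite sqrt_sqrt by lra. unfold r. field. auto. }
    replace (2 * eps / (sqrt r + 1) * D)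
      with (2 * eps * D / (sqrt r + 1)) by (field; lra).
    rewrite hD. field. lra. }
  assert (hbetween : 0 <= (xi - a) * (y - a) /\ Rabs (xi - a) <= Rabs (y - a)).
  { destruct (Rle_dec a y).
    - rewrite Rmin_left, Rmax_right in hxi by lra.
      rewrite !Rabs_pos_eq by lra. split; [apply Rmult_le_pos |]; lra.
    - rewrite Rmin_right, Rmax_left in hxi by lra.
      rewrite <- (Rabs_Ropp (xi - a)), <- (Rabs_Ropp (y - a)), !Rabs_pos_eq by lra.
      split; [| lra].
      replace ((xi - a) * (y - a)) with (- (xi - a) * - (y - a)) by ring.
      apply Rmult_le_pos; lra. }
  destruct hbetween as [hpos hle].
  assert (hmono := cos_double_monotone a xi ha (Rle_trans _ _ _ hle hy)).
  rewrite hcos in hmono. fold D in hmono.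
  replace (U0 * a * ((slope eps U0 theta0 xi - U0) * (y - a)))
    with (U0 * (slope eps U0 theta0 xi - U0) * (a * (y - a))) by ring.
  rewrite hm, Rmult_assoc.
  apply Rmult_le_pos.
  { apply Rlt_le, Rdiv_lt_0_compat; lra. }
  destruct (Req_dec xi a) as [-> | hne].
  { replace D with 0 by (unfold D; rewrite hcos; ring). lra. }
  replace (D * (a * (y - a)))
    with (a * (xi - a) * D * ((xi - a) * (y - a) / (xi - a) ^ 2)) by (field; lra).
  apply Rmult_le_pos; auto.
  apply Rdiv_le_0_compat; auto. apply pow2_gt_0. lra.
Qed.

(** Completing the square around the slope leaves a null Lagrangian, namely the
    derivative of the slope primitive along the curve, and a constant. *)
Lemma energy_density_calibration (eps U0 theta0 x p : R) :
  0 < eps -> 2 * eps * (1 + cos (2 * theta0)) < U0 ^ 2 ->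
  / 2 * (p - U0) ^ 2 + eps * cos (2 * x)
  = / 2 * (p - slope eps U0 theta0 x) ^ 2
    + (slope eps U0 theta0 x - U0) * p + eps * cos (2 * theta0).
Proof.
  intros heps hgap. assert (h := slope_sqr eps U0 theta0 x heps hgap). lra.
Qed.

(** The radius of the neighbourhood keeps the two end values of a competitor in
    the range of [cos_double_monotone]. *)
Lemma perversion_stable (eps L U0 : R) (theta : R -> R) (theta0 : R)
  (T Psi : R -> R) :
  0 < eps -> 0 < L ->
  (forall x, segment 0 L x ->
     T x = theta x /\ derive_on 0 L theta x = Psi x) ->
  perversion_orbit eps L U0 theta0 T Psi ->
  PI / 2 < Rabs theta0 < PI ->
  stable eps L U0 theta.
Proof.
  intros heps hL heq horb hth.
  assert (hgap := perversion_speed_gap _ _ _ _ _ _ heps hL horb (proj1 hth)).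
  destruct (slope_radicand eps U0 theta0 0 heps hgap) as [hU _].
  destruct (perversion_sign _ _ _ _ _ _ hL horb) as [hth0 hUth].
  assert (hUth' : 0 < U0 * theta0).
  { assert (U0 * theta0 <> 0)
      by (apply Rmult_integral_contrapositive; now split). lra. }
  set (delta := Rmin (Rabs theta0 - PI / 2) (PI - Rabs theta0)).
  exists delta. split; [apply Rmin_glb_lt; lra |].
  intros g hg hnorm.
  destruct (C1_extension 0 L g hL hg) as (G & dG & hG).
  rewrite (energy_eq eps L U0 theta T Psi hL heq).
  rewrite (energy_eq eps L U0 g G dG hL)
    by (intros x hx; destruct (hG x hx) as (? & ? & _); auto).
  assert (s0 : segment 0 L 0) by (split; lra).
  assert (sL : segment 0 L L) by (split; lra).
  assert (hnear : forall x, segment 0 L x -> Rabs (G x - T x) <= delta).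
  { intros x hx. rewrite (proj1 (hG x hx)), (proj1 (heq x hx)).
    left. now apply (C1_norm_gt 0 L (fun x => g x - theta x)). }
  set (F := slope_primitive eps U0 theta0).
  assert (hF : forall x, is_derive F x (slope eps U0 theta0 x - U0))
    by (intros; apply slope_primitive_derive).
  assert (hdF : forall (Y dY : R -> R) x, is_derive Y x (dY x) -> continuous dY x ->
            is_derive (fun s => F (Y s)) x ((slope eps U0 theta0 (Y x) - U0) * dY x)
            /\ continuous (fun s => (slope eps U0 theta0 (Y s) - U0) * dY s) x).
  { intros Y dY x hY hdY. split.
    - evar_last; [apply (is_derive_comp F Y); [apply hF | exact hY] |].
      unfold scal; simpl; unfold mult; simpl. ring.
    - apply (continuous_mult (fun s => slope eps U0 theta0 (Y s) - U0) dY); auto.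
      apply (continuous_comp Y (fun y => slope eps U0 theta0 y - U0)).
      + now apply continuous_of_is_derive with (1 := hY).
      + apply slope_minus_continuous. }
  assert (hcont : forall x, segment 0 L x -> continuous Psi x).
  { intros x hx.
    apply continuous_of_is_derive with (1 := orbit_dPsi _ _ _ _ _ _ horb x hx). }
  assert (hdiff : RInt (fun s => / 2 * (Psi s - U0) ^ 2 + eps * cos (2 * T s)) 0 L
      - RInt (fun s => / 2 * (dG s - U0) ^ 2 + eps * cos (2 * G s)) 0 L
      <= (F (T L) - F (G L)) - (F (T 0) - F (G 0))).
  { apply (RInt_diff_le _ _ (fun s => F (T s) - F (G s))
      (fun s => (slope eps U0 theta0 (T s) - U0) * Psi s
                - (slope eps U0 theta0 (G s) - U0) * dG s)); [lra | | |];
      intros x hx; assert (dT := orbit_dT _ _ _ _ _ _ horb x hx);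
      destruct (hG x hx) as (_ & _ & dGx & cGx).
    - split; apply continuous_energy_density; auto;
        eapply continuous_of_is_derive; eauto.
    - destruct (hdF T Psi x dT (hcont x hx)) as [a1 a2].
      destruct (hdF G dG x dGx cGx) as [b1 b2].
      split.
      + now apply (is_derive_minus (fun s => F (T s)) (fun s => F (G s))).
      + now apply (continuous_minus
          (fun s => (slope eps U0 theta0 (T s) - U0) * Psi s)
          (fun s => (slope eps U0 theta0 (G s) - U0) * dG s)).
    - rewrite (energy_density_calibration eps U0 theta0 (T x) (Psi x) heps hgap).
      rewrite (energy_density_calibration eps U0 theta0 (G x) (dG x) heps hgap).
      rewrite <- (orbit_slope eps L U0 theta0 T Psi x) by auto.
      assert (h := pow2_ge_0 (dG x - slope eps U0 theta0 (G x))). lra. }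
  assert (hendL : 0 <= U0 * theta0 * (F (G L) - F theta0)).
  { apply slope_primitive_extremum; auto.
    rewrite <- (orbit_TL _ _ _ _ _ _ horb) at 1. now apply hnear. }
  assert (hend0 : 0 <= U0 * - theta0 * (F (G 0) - F (- theta0))).
  { apply slope_primitive_extremum; auto.
    - now rewrite Rabs_Ropp.
    - replace (2 * - theta0) with (- (2 * theta0)) by ring. apply cos_neg.
    - rewrite Rabs_Ropp. rewrite <- (orbit_T0 _ _ _ _ _ _ horb) at 1.
      now apply hnear. }
  rewrite (orbit_T0 _ _ _ _ _ _ horb), (orbit_TL _ _ _ _ _ _ horb) in hdiff.
  assert (hsum : 0 <= U0 * theta0 *
            ((F (G L) - F theta0) - (F (G 0) - F (- theta0)))) by lra.
  assert (0 <= (F (G L) - F theta0) - (F (G 0) - F (- theta0))).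
  { apply Rmult_le_reg_l with (1 := hUth'). lra. }
  lra.
Qed.

(** * Stability of perversions *)

Theorem mainTheorem3 (eps L U0 : R) (theta : R -> R) (theta0 : R)
  (heps : 0 < eps) (hL : 0 < L)
  (hsol : bvp_solution eps L U0 theta)
  (hperv : perversion L theta)
  (htheta0 : theta0 = theta L)
  (hbound : Rabs theta0 < PI) :
  (Rabs theta0 < PI / 2 -> unstable eps L U0 theta) /\
  (PI / 2 < Rabs theta0 -> stable eps L U0 theta).
Proof.
  destruct (perversion_orbit_of_solution eps L U0 theta hL hsol hperv)
    as (T & Psi & heq & horb).
  rewrite <- htheta0 in horb.
  split; intros hth.
  - destruct (perversion_sign _ _ _ _ _ _ hL horb) as [h0 hU].
    assert (hs : 0 < theta0 * sin (2 * theta0)).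
    { apply Rabs_def2 in hth.
      destruct (Rlt_dec 0 theta0).
      - apply Rmult_lt_0_compat; auto. apply sin_gt_0; lra.
      - assert (hn : 0 < sin (- (2 * theta0))) by (apply sin_gt_0; lra).
        rewrite sin_neg in hn.
        replace (theta0 * sin (2 * theta0))
          with (- theta0 * - sin (2 * theta0)) by ring.
        apply Rmult_lt_0_compat; lra. }
    apply perversion_unstable with theta0 T Psi; auto.
    + intros hz. rewrite hz in hs. lra.
    + replace (U0 * sin (2 * theta0))
        with (U0 * theta0 * (theta0 * sin (2 * theta0) / theta0 ^ 2))
        by (field; auto).
      apply Rmult_le_pos; auto.
      apply Rlt_le, Rdiv_lt_0_compat; auto. apply pow2_gt_0. auto.
  - apply perversion_stable with theta0 T Psi; auto.
Qed.
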